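(* Let $(X_n,x_n)$, $n\ge1$, and $(X,x)$ be pointed Gromov product spaces, and suppose that $(X_n,x_n)\to(X,x)$ in the pointed Gromov-Hausdorff sense. If the boundaries $\{(\partial_P X_n,\rho_{x_n})\}_{n\ge1}$ form an equicontinuous family of antipodal spaces, then $(\partial_P X_n,\rho_{x_n})\to(\partial_P X,\rho_x)$ in the sense of almost-isometric convergence.
   Context: **Semi-metric and antipodal spaces.** A compact semi-metric space $(Z,\rho)$ is a compact metrizable space $Z$ with at least four points together with a continuous symmetric function $\rho:Z\times Z\to[0,\infty)$ with $\rho(\xi,\eta)=0$ iff $\xi=\eta$. It is an antipodal space if moreover $\sup_{\xi,\eta}\rho(\xi,\eta)=1$ and for every $\xi\in Z$ there is $\eta\in Z$ with $\rho(\xi,\eta)=1$. **Equicontinuity.** A family $\{(Z_\lambda,\rho_\lambda)\}_{\lambda\in\Lambda}$ of compact semi-metric spaces is equicontinuous if for every $\epsilon>0$ there is $\delta>0$ such that for all $\lambda\in\Lambda$ and all $\xi,\eta\in Z_\lambda$ with $\rho_\lambda(\xi,\eta)<\delta$ we have $\sup_{\zeta\in Z_\lambda}|\rho_\lambda(\xi,\zeta)-\rho_\lambda(\eta,\zeta)|<\epsilon$. **Gromov product spaces.** In a metric space $X$, $(y|z)_x=\frac12(d(y,x)+d(z,x)-d(y,z))$. A Gromov product space is a proper, geodesic, geodesically complete (every geodesic segment extends to a bi-infinite geodesic) metric space $X$ having a second countable Hausdorff compactification $\hat X$ such that for every $x\in X$ the Gromov product $(\cdot|\cdot)_x$ extends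 to a continuous function $\hat X\times\hat X\to[0,+\infty]$ and, for $\xi,\eta\in\hat X\setminus X$, $(\xi|\eta)_x=+\infty$ iff $\xi=\eta$. The compactification $\hat X$ is unique up to equivalence; $\partial_P X=\hat X\setminus X$ is the Gromov product boundary. For $x\in X$, $\rho_x=\exp(-(\cdot|\cdot)_x)$ on $\partial_P X$; $(\partial_P X,\rho_x)$ is an antipodal space (boundaries are understood to have at least four points). **Almost-isometric (AI) convergence.** For $\epsilon>0$, an $\epsilon$-isometry $f:(Z_1,\rho_1)\to(Z_2,\rho_2)$ between compact semi-metric spaces is a (not necessarily continuous) map with $\sup_{\xi,\eta\in Z_1}|\rho_2(f(\xi),f(\eta))-\rho_1(\xi,\eta)|<\epsilon$ and such that every point $\eta\in Z_2$ satisfies $\rho_2(f(\zeta),\eta)<\epsilon$ for some $\zeta\in Z_1$. Let $d_{AI}((Z_1,\rho_1),(Z_2,\rho_2))$ be the infimum of $\epsilon>0$ for which there are $\epsilon$-isometries $Z_1\to Z_2$ and $Z_2\to Z_1$. AI-convergence $(Z_n,\rho_n)\to(Z,\rho_0)$ means $d_{AI}((Z_n,\rho_n),(Z,\rho_0))\to0$. **Pointed Gromov-Hausdorff convergence.** A map $f:X\to Y$ of metric spaces (not necessarily continuous) is an $\epsilon$-isometry if $\sup_{x_1,x_2}|d_Y(f(x_1),f(x_2))-d_X(x_1,x_2)|<\epsilon$ and $Y=\bigcup_{x\in X}B_Y(f(x),\epsilon)$. For pointed proper geodesic metric spaces, $(X_n,p_n)\to(X,p)$ means: for every $R>0$ and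 $\epsilon>0$ there is $n_0$ such that for all $n\ge n_0$ there is an $\epsilon$-isometry $f:B_{X_n}(p_n,R)\to B_X(p,R)$ with $f(p_n)=p$. Balls $B_X(p,R)$ are closed. *)

(* Defs.v *)
From HB Require Import structures.
From mathcomp Require Import all_boot all_order all_algebra.
From mathcomp Require Import all_classical all_reals all_analysis.

Set Implicit Arguments.
Unset Strict Implicit.
Unset Printing Implicit Defensive.

Import Order.TTheory GRing.Theory Num.Theory.
Import numFieldNormedType.Exports.

Local Open Scope classical_set_scope.
Local Open Scope ring_scope.

(* Suprema and infima below are taken in [\bar R] ([ereal_sup], [ereal_inf]),
   since [sup] and [inf] on [R] take the value 0 on sets without one. *)

Section semimetric_spaces.
Context {R : realType}.

Definition metrizable (Z : topologicalType) : Prop :=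
  exists d : Z -> Z -> R,
    [/\ forall a b, d a b = 0 <-> a = b,
        forall a b, d a b = d b a,
        forall a b c, d a c <= d a b + d b c &
        forall a (U : set Z),
          nbhs a U <-> exists2 e, 0 < e & [set b | d a b < e] `<=` U].

Definition at_least_four_points (Z : Type) : Prop :=
  exists f : 'I_4 -> Z, injective f.

Record compact_semimetric_space (Z : topologicalType) (rho : Z -> Z -> R)
    : Prop := {
  semimetric_compact : compact [set: Z] ;
  semimetric_metrizable : metrizable Z ;
  semimetric_four_points : at_least_four_points Z ;
  semimetric_continuous : continuous (fun p : Z * Z => rho p.1 p.2) ;
  semimetric_sym : forall a b, rho a b = rho b a ;
  semimetric_ge0 : forall a b, 0 <= rho a b ;
  semimetric_eq0 : forall a b, rho a b = 0 <-> a = b }.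

Definition antipodal_space (Z : topologicalType) (rho : Z -> Z -> R) : Prop :=
  [/\ compact_semimetric_space rho,
      ereal_sup (range (fun p : Z * Z => (rho p.1 p.2)%:E)) = 1%E &
      forall a, exists b, rho a b = 1].

Definition equicontinuous_family (I : Type) (Z : I -> Type)
    (rho : forall i, Z i -> Z i -> R) : Prop :=
  forall e : R, 0 < e -> exists2 delta : R, 0 < delta &
    forall (i : I) (a b : Z i), rho i a b < delta ->
      (ereal_sup (range (fun c => `|rho i a c - rho i b c|%:E)) < e%:E)%E.

Definition semimetric_eps_isometry (Z1 Z2 : Type) (rho1 : Z1 -> Z1 -> R)
    (rho2 : Z2 -> Z2 -> R) (e : R) (f : Z1 -> Z2) : Prop :=
  (ereal_sup (range (fun p : Z1 * Z1 =>
      `|rho2 (f p.1) (f p.2) - rho1 p.1 p.2|%:E)) < e%:E)%E /\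
  forall b : Z2, exists c : Z1, rho2 (f c) b < e.

Definition ai_dist (Z1 Z2 : Type) (rho1 : Z1 -> Z1 -> R)
    (rho2 : Z2 -> Z2 -> R) : \bar R :=
  ereal_inf [set e%:E | e in [set e : R |
    [/\ 0 < e,
        exists f : Z1 -> Z2, semimetric_eps_isometry rho1 rho2 e f &
        exists g : Z2 -> Z1, semimetric_eps_isometry rho2 rho1 e g]]].

Definition ai_converges (Z_ : nat -> Type)
    (rho_ : forall n, Z_ n -> Z_ n -> R) (Z : Type) (rho : Z -> Z -> R) : Prop :=
  ai_dist (rho_ n) rho @[n --> \oo] --> 0%E.

End semimetric_spaces.

Section metric_spaces.
Context {R : realType}.

(* The library's [closed_ball] is the closure of the open ball, which can be
   smaller. *)
Definition cball (X : metricType R) (p : X) (r : R) : set X :=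
  [set y | mdist p y <= r].

Definition proper_space (X : metricType R) : Prop :=
  forall (p : X) (r : R), compact (cball p r).

Definition geodesic_on (X : metricType R) (A : set R) (g : R -> X) : Prop :=
  forall s t, A s -> A t -> mdist (g s) (g t) = `|s - t|.

Definition geodesic_space (X : metricType R) : Prop :=
  forall p q : X, exists g : R -> X,
    [/\ g 0 = p, g (mdist p q) = q & geodesic_on `[0, mdist p q] g].

Definition geodesically_complete (X : metricType R) : Prop :=
  forall (a b : R) (g : R -> X), a <= b -> geodesic_on `[a, b] g ->
    exists2 h : R -> X, geodesic_on setT h & {in `[a, b], h =1 g}.

(* An e-isometry from the subspace [A] of [X] to the subspace [B] of [Y]; the
   values of [f] outside of [A] are irrelevant. *)
Definition metric_eps_isometry (X Y : metricType R) (A : set X) (B : set Y)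
    (e : R) (f : X -> Y) : Prop :=
  [/\ set_fun A B f,
      (ereal_sup [set `|mdist (f p.1) (f p.2) - mdist p.1 p.2|%:E
                 | p in A `*` A] < e%:E)%E &
      B `<=` \bigcup_(a in A) cball (f a) e].

Definition pointed_gh_converges (X_ : nat -> metricType R)
    (p_ : forall n, X_ n) (X : metricType R) (p : X) : Prop :=
  forall r e : R, 0 < r -> 0 < e -> \forall n \near \oo,
    exists2 f : X_ n -> X,
      metric_eps_isometry (cball (p_ n) r) (cball p r) e f & f (p_ n) = p.

Definition gromov_product (X : metricType R) (p y z : X) : R :=
  2^-1 * (mdist y p + mdist z p - mdist y z).

End metric_spaces.

Section compactifications.
Context {R : realType}.

Definition topological_embedding (X Y : topologicalType) (i : X -> Y) : Prop :=
  injective i /\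
  forall U : set X, open U <-> exists2 V : set Y, open V & i @^-1` V = U.

Definition compactification (X Y : topologicalType) (i : X -> Y) : Prop :=
  [/\ compact [set: Y], hausdorff_space Y, topological_embedding i &
      dense (range i)].

Definition extends_gromov_product (X : metricType R) (Xhat : topologicalType)
    (i : X -> Xhat) (p : X) (G : Xhat * Xhat -> \bar R) : Prop :=
  [/\ continuous G, forall w, (0 <= G w)%E &
      forall y z : X, G (i y, i z) = (gromov_product p y z)%:E].

Definition boundary (X Xhat : Type) (i : X -> Xhat) : set Xhat := ~` range i.

Definition gromov_compactification (X : metricType R) (Xhat : topologicalType)
    (i : X -> Xhat) : Prop :=
  [/\ compactification i, @second_countable Xhat &
      forall p : X, exists2 G, extends_gromov_product i p G &
        forall xi eta, boundary i xi -> boundary i eta ->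
          (G (xi, eta) = +oo%E <-> xi = eta)].

(* The continuous extension is unique, as the image of [i] is dense, so
   [xget] picks it; the default value is never used. *)
Definition extended_gromov_product (X : metricType R) (Xhat : topologicalType)
    (i : X -> Xhat) (p : X) : Xhat * Xhat -> \bar R :=
  xget (fun=> 0%E) [set G | extends_gromov_product i p G].

End compactifications.

(* The compactification [gps_hat] is determined by the metric space up to
   equivalence, so carrying it along as data loses no generality. *)
Record gromovProductSpace (R : realType) := GromovProductSpace {
  gps_space :> metricType R ;
  gps_hat : topologicalType ;
  gps_incl : gps_space -> gps_hat ;
  gps_proper : proper_space gps_space ;
  gps_geodesic : geodesic_space gps_space ;
  gps_complete : geodesically_complete gps_space ;
  gps_compactification : gromov_compactification gps_incl ;
  gps_four_points : at_least_four_points (boundary gps_incl) }.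

(* As a type, [gromov_boundary X] carries the subspace topology of
   [gps_hat X]. *)
Definition gromov_boundary (R : realType) (X : gromovProductSpace R) :
    set (gps_hat X) :=
  boundary (@gps_incl R X).
Arguments gromov_boundary {R} X.

Definition boundary_rho (R : realType) (X : gromovProductSpace R) (p : X)
    (xi eta : gromov_boundary X) : R :=
  fine (expeR (- extended_gromov_product (@gps_incl R X) p
                   (set_val xi, set_val eta))%E).

(* Main.v *)
Require Import Defs.
From mathcomp Require Import all_boot all_order all_algebra.
From mathcomp Require Import all_classical all_reals all_analysis.
From mathcomp Require Import lra.

(** Write [i : X -> X^] for the compactification and let [rho_hat p] be the
    continuous function [exp (- (u|v)_p)] on [X^ * X^], so that [rho_p] is its
    restriction to the boundary. The boundary distances are read off from a
    large ball of [X], in a way that is uniform over the family, and the ball is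
    what Gromov-Hausdorff convergence controls.

    Say that a boundary point [xi] lies behind [a] (predicate [behind]) when
    [(a|xi)_p = d(a,p)], that is, when [xi] is the end of a ray that starts at
    [p] and passes through [a]. Every [a] has a boundary point behind it, since
    geodesics extend ([behind_exists]), and every [xi] lies behind some point at
    any prescribed distance from [p], by properness ([in_front_exists]). The
    core is the comparison of [rho_p(xi,eta)] with [exp (- (a|b)_p)] for [xi]
    behind [a] and [eta] behind [b].

    - [rho_p(xi,eta) <= exp (- (a|b)_p)] always holds
      ([boundary_rho_le_rho_hat]), by the inequality
      [rho_hat p u v <= e^d(a,p) * rho_hat p a u * rho_hat p a v], which is the
      triangle inequality for [a] in exponential form.
    - Conversely ([rho_hat_le_boundary_rho]), extend a geodesic from [a] to [b]
      to a line, with ends [xi'] beyond [a] and [eta'] beyond [b]. Then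
      [exp (- (a|b)_p) <= rho_p(xi',eta')], while [rho_p(xi,xi')] and
      [rho_p(eta,eta')] are at most [e^(-r) / exp (- (a|b)_p)] when [a] and [b]
      are at distance at least [r] from [p]. Either [exp (- (a|b)_p)] is already
      below the tolerance, or, for [r] large, [xi'] is close to [xi] and [eta']
      to [eta], and equicontinuity transfers the bound to [rho_p(xi,eta)].
      How large [r] must be depends on the modulus of equicontinuity only.

    The limit space has a modulus too, by compactness of [X^]
    ([rho_hat_modulus]). A Gromov-Hausdorff approximation between the balls of
    radius [r] is a correspondence of small distortion, hence of small
    distortion for Gromov products. Going from [xi] to a point [a] in front of
    it, to a point that corresponds to [a], and to a boundary point behind the
    latter gives the almost-isometry of the boundaries
    ([correspondence_eps_isometry]); correspondences being symmetric, the same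
    lemma gives the map in the other direction. *)

Set Implicit Arguments.
Unset Strict Implicit.
Unset Printing Implicit Defensive.

Import Order.TTheory GRing.Theory Num.Theory.
Import numFieldNormedType.Exports.

Local Open Scope classical_set_scope.
Local Open Scope ring_scope.

(** * The exponential on extended reals *)

Section exponential.
Context {R : realType}.
Implicit Types (r s t : R).

Lemma continuous_fine_expeRN (w : \bar R) : (0 <= w)%E ->
  {for w, continuous (fun w : \bar R => fine (expeR (- w)))}.
Proof.
case: w => [r _|_|//].
- have /fine_cvgP[fin cvgr] : (fun w : \bar R => w) @ r%:E --> r%:E.
    exact: cvg_id.
  have : expR (- fine w) @[w --> r%:E] --> expR (- r).
    apply: continuous_cvg; first exact: continuous_expR.
    exact: cvgN.
  apply: cvg_trans; apply: near_eq_cvg.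
  by move: fin; apply: filterS => -[].
- apply/(@cvgrPdist_lt _ _ _ _ (nbhs_filter (+oo%E : \bar R))) => e e0.
  have : (\forall w \near (+oo%E : \bar R), (- ln e)%:E < w)%E.
    by exists (- ln e); split => //; exact: num_real.
  apply: filterS => w; rewrite /= sub0r normrN.
  case: w => [s|//|//] /=; last by rewrite normr0.
  rewrite lte_fin ger0_norm ?expR_ge0// => H.
  by rewrite -[ltRHS](lnK e0)// ltr_expR ltrNl.
Qed.

Lemma expRN_lipschitz s t : 0 <= s ->
  expR (- s) <= expR (- t) + `|s - t|.
Proof.
move=> s0.
case: (leP t s) => [ts|st].
  by rewrite -[leLHS]addr0 lerD// ler_expR lerN2.
have E : expR (- t) = expR (- s) * expR (s - t).
  by rewrite -expRD addrA [- s + s]addrC subrr add0r.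
have := expR_ge1Dx (s - t).
have h1 : expR (- s) <= 1 by rewrite -expR0 ler_expR oppr_le0.
have h0 := expR_ge0 (- s).
rewrite E ltr0_norm ?subr_lt0// => h.
have : expR (- s) * (1 + (s - t)) <= expR (- s) * expR (s - t).
  by rewrite ler_wpM2l.
nra.
Qed.

End exponential.

Lemma closed_le_fun (R : realType) (T : topologicalType) (f g : T -> R) :
  continuous f -> continuous g -> closed [set u | f u <= g u].
Proof.
move=> cf cg.
have -> : [set u | f u <= g u] = (fun u => g u - f u) @^-1` [set x | 0 <= x].
  by apply/seteqP; split => u /=; rewrite subr_ge0.
apply: preimage_closed; last exact: closed_ge.
by move=> u _; apply: cvgB; [exact: cg|exact: cf].
Qed.

(** * The boundary semi-metric on the compactification *)

Section extension.
Context {R : realType} {X : gromovProductSpace R}.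
Local Notation hat := (gps_hat X).
Local Notation i := (@gps_incl R X).

(** Identities and inequalities between continuous functions on the square of
    the compactification need only be checked on pairs of points of [X]. *)
Lemma dense_square (C : set (hat * hat)) :
  closed C -> (forall y z : X, C (i y, i z)) -> forall q, C q.
Proof.
move=> cC Cyz q; apply: contrapT => nCq.
have : nbhs q (~` C) by apply: open_nbhs_nbhs; split=> //; exact: closed_openC.
case=> -[A B] [/=]; rewrite !nbhsE => -[A' [oA Aq] AA] [B' [oB Bq] BB] sub.
have [[_ _ _ dn] _ _] := gps_compactification X.
have [|y' [Ay [y _ yE]]] := dn A' _ oA; first by exists q.1.
have [|z' [Bz [z _ zE]]] := dn B' _ oB; first by exists q.2.
apply: (sub (i y, i z)); last exact: Cyz.
by split; [apply: AA; rewrite /= yE|apply: BB; rewrite /= zE].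
Qed.

Lemma dense_square_le (f g : hat * hat -> R) : continuous f -> continuous g ->
  (forall y z : X, f (i y, i z) <= g (i y, i z)) -> forall q, f q <= g q.
Proof. by move=> cf cg fg; apply: dense_square (closed_le_fun cf cg) fg. Qed.

Lemma extension_continuous (p : X) (G : hat * hat -> \bar R) :
  extends_gromov_product i p G -> continuous (fun q => fine (expeR (- G q))).
Proof.
case=> cG G0 _ q.
have := continuous_fine_expeRN (G0 q).
by move=> /(continuous_comp (cG q)).
Qed.

Lemma extended_gromov_productP (p : X) :
  extends_gromov_product i p (extended_gromov_product i p).
Proof.
have [_ _ /(_ p)[G GP _]] := gps_compactification X.
by rewrite /extended_gromov_product; apply: (xgetI _ GP).
Qed.

Definition rho_hat (p : X) (u v : hat) : R :=
  fine (expeR (- extended_gromov_product i p (u, v))%E).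

Lemma rho_hat_continuous p : continuous (fun q => rho_hat p q.1 q.2).
Proof.
have -> : (fun q => rho_hat p q.1 q.2) =
    (fun q => fine (expeR (- extended_gromov_product i p q))).
  by apply/funext => -[].
exact: extension_continuous (extended_gromov_productP p).
Qed.

Lemma rho_hat_incl p y z :
  rho_hat p (i y) (i z) = expR (- gromov_product p y z).
Proof. by rewrite /rho_hat; have [_ _ ->] := extended_gromov_productP p. Qed.

Lemma rho_hat_ge0 p u v : 0 <= rho_hat p u v.
Proof. by rewrite /rho_hat fine_ge0// expeR_ge0. Qed.

Lemma continuous_rho_hat_comp (T : topologicalType) p (f g : T -> hat) :
  continuous f -> continuous g -> continuous (fun t => rho_hat p (f t) (g t)).
Proof.
move=> cf cg t.
apply: (@continuous_comp _ _ _ (fun t => (f t, g t))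
  (fun q => rho_hat p q.1 q.2)); last exact: rho_hat_continuous.
by apply: cvg_pair; [exact: cf|exact: cg].
Qed.

Lemma rho_hat_continuousr p u : continuous (rho_hat p u).
Proof.
apply: continuous_rho_hat_comp => v; [exact: cvg_cst|exact: cvg_id].
Qed.

Lemma rho_hat_sym p u v : rho_hat p u v = rho_hat p v u.
Proof.
have cs : continuous (fun q : hat * hat => rho_hat p q.2 q.1).
  by apply: continuous_rho_hat_comp => q; [exact: cvg_snd|exact: cvg_fst].
have H y z : gromov_product p y z = gromov_product p z y.
  by rewrite /gromov_product (metric_sym y z) (addrC (mdist y p)).
apply/eqP; rewrite eq_le; apply/andP; split.
  apply: (dense_square_le (@rho_hat_continuous p) cs _ (u, v)) => y z /=.
  by rewrite !rho_hat_incl H.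
apply: (dense_square_le cs (@rho_hat_continuous p) _ (u, v)) => y z /=.
by rewrite !rho_hat_incl H.
Qed.

(** On [X] this is [d(u,v) <= d(u,a) + d(a,v)], expanded in Gromov products
    based at [p]. *)
Lemma rho_hat_triangle p a u v :
  rho_hat p u v <= expR (mdist a p) * rho_hat p (i a) u * rho_hat p (i a) v.
Proof.
have H : continuous (fun q => expR (mdist a p) * rho_hat p (i a) q.1 *
    rho_hat p (i a) q.2).
  move=> q; apply: cvgM; first (apply: cvgM; first exact: cvg_cst).
    exact: (continuous_rho_hat_comp (f := fun=> i a) (g := fst)
      (@cst_continuous _ _ _) (fun=> cvg_fst)).
  exact: (continuous_rho_hat_comp (f := fun=> i a) (g := snd)
    (@cst_continuous _ _ _) (fun=> cvg_snd)).
apply: (dense_square_le (@rho_hat_continuous p) H _ (u, v)) => y z /=.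
rewrite !rho_hat_incl -!expRD ler_expR /gromov_product.
have := metric_triangle y a z; rewrite (metric_sym a y); lra.
Qed.

(** On [X] this is [(y|v)_p <= d(y,p)]; it keeps [rho_hat] away from 0 as soon
    as one argument is in [X]. *)
Lemma rho_hat_incl_ge p y v : expR (- mdist y p) <= rho_hat p (i y) v.
Proof.
have H : continuous (fun q : hat * hat => rho_hat p (i y) q.2).
  exact: (continuous_rho_hat_comp (f := fun=> i y) (g := snd)
    (@cst_continuous _ _ _) (fun=> cvg_snd)).
apply: (dense_square_le (f := fun=> expR (- mdist y p)) _ H _ (v, v)).
  by move=> q; exact: cvg_cst.
move=> _ z /=; rewrite rho_hat_incl ler_expR /gromov_product.
have := metric_triangle y p z; have := metric_triangle z y p.
by have := metric_sym z y; have := metric_sym z p; lra.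
Qed.

Lemma rho_hat_incl_neq0 p y v : rho_hat p (i y) v != 0.
Proof.
by rewrite gt_eqF// (lt_le_trans (expR_gt0 _) (rho_hat_incl_ge _ _ _)).
Qed.

(** The compactification comes with some extension of the Gromov product for
    which this holds; by density it has the same exponential as the one that
    defines [rho_hat]. *)
Lemma rho_hat_boundary0 p xi eta : boundary i xi -> boundary i eta ->
  rho_hat p xi eta = 0 <-> xi = eta.
Proof.
move=> bxi beta.
have [_ _ /(_ p)[G GP Gb]] := gps_compactification X.
have -> : rho_hat p xi eta = fine (expeR (- G (xi, eta))).
  have cG := extension_continuous GP.
  have [_ _ GE] := GP.
  apply/eqP; rewrite eq_le; apply/andP; split.
    apply: (dense_square_le (@rho_hat_continuous p) cG _ (xi, eta)) => y z /=.
    by rewrite rho_hat_incl GE.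
  apply: (dense_square_le cG (@rho_hat_continuous p) _ (xi, eta)) => y z /=.
  by rewrite rho_hat_incl GE.
rewrite -(Gb _ _ bxi beta).
have [_ /(_ (xi, eta)) + _] := GP.
case: (G (xi, eta)) => [r|//|//] /= _; split => //.
by move/eqP; rewrite gt_eqF ?expR_gt0.
Qed.

Lemma rho_hat_eq0 p u v : rho_hat p u v = 0 -> u = v.
Proof.
move=> uv0.
have [[y _ yu]|bu] := pselect (range i u).
  by move/eqP: uv0; rewrite -yu (negbTE (rho_hat_incl_neq0 _ _ _)).
have [[z _ zv]|bv] := pselect (range i v).
  by move/eqP: uv0; rewrite rho_hat_sym -zv (negbTE (rho_hat_incl_neq0 _ _ _)).
exact/(rho_hat_boundary0 p bu bv).
Qed.

(** On the compact set of triples [(u,v,w)] that violate the conclusion,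
    [rho_hat p u v] is positive, because it vanishes only if [u = v]; its
    minimum there is a suitable [delta]. *)
Lemma rho_hat_modulus p e : 0 < e -> exists2 delta, 0 < delta &
  forall u v, rho_hat p u v < delta ->
    forall w, `|rho_hat p u w - rho_hat p v w| < e.
Proof.
move=> e0.
have [[cX _ _ _] _ _] := gps_compactification X.
pose K := [set q : hat * hat * hat |
  e <= `|rho_hat p q.1.1 q.2 - rho_hat p q.1.2 q.2|].
have c1 : continuous (fun q : hat * hat * hat => q.1.1).
  by move=> q; apply: (@continuous_comp _ _ _ fst fst); exact: cvg_fst.
have c2 : continuous (fun q : hat * hat * hat => q.1.2).
  move=> q; apply: (@continuous_comp _ _ _ fst snd); first exact: cvg_fst.
  exact: cvg_snd.
have c3 : continuous (fun q : hat * hat * hat => q.2).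
  by move=> q; exact: cvg_snd.
have cuv := @continuous_rho_hat_comp _ p _ _ c1 c2.
have cuw := @continuous_rho_hat_comp _ p _ _ c1 c3.
have cvw := @continuous_rho_hat_comp _ p _ _ c2 c3.
have cK : compact K.
  have cT : compact [set: hat * hat * hat].
    by rewrite -!setXTT; do ?apply: compact_setX.
  apply: (subclosed_compact _ cT) => //.
  apply: closed_le_fun => q; first exact: cvg_cst.
  by apply: cvg_norm; apply: cvgB; [exact: cuw|exact: cvw].
have [K0|/nonemptyPn K0] := pselect (K !=set0); last first.
  exists 1 => // u v _ w; rewrite ltNge; apply/negP => h.
  by have : K (u, v, w) by []; rewrite K0.
have [[[u v] w]] := compact_EVT_min K0 cK (continuous_subspaceT cuv).
rewrite inE /K /= => Kuvw min.
exists (rho_hat p u v) => [|u' v' lt w'].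
  rewrite lt_neqAle rho_hat_ge0 andbT eq_sym; apply/eqP => /rho_hat_eq0 uv.
  by move: Kuvw; rewrite uv subrr normr0 leNgt e0.
rewrite ltNge; apply/negP => h.
have /min : (u', v', w') \in K by rewrite inE.
by rewrite /= leNgt lt.
Qed.

End extension.

(** * Rays, and points behind other points *)

Section rays.
Context {R : realType} {X : gromovProductSpace R}.
Local Notation hat := (gps_hat X).
Local Notation i := (@gps_incl R X).
Implicit Types (p a b : X) (u v w : hat) (xi eta zeta : gromov_boundary X).

Lemma boundary_point u : boundary i u -> exists xi, set_val xi = u.
Proof. by move=> bu; exists (SigSub (mem_set bu)). Qed.

Lemma boundary_rhoE p xi eta :
  boundary_rho p xi eta = rho_hat p (set_val xi) (set_val eta).
Proof. by []. Qed.

Lemma boundary_set_val xi : boundary i (set_val xi).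
Proof. exact: set_valP. Qed.

(** The end is a cluster point of [h t] in the compactification as [t] goes to
    infinity: closed conditions that hold far along the line pass to it, and
    inequalities between Gromov products are such conditions. *)
Lemma line_end (h : R -> X) : geodesic_on setT h ->
  exists xi, forall (F : set hat) T, closed F ->
    (forall t, T <= t -> F (i (h t))) -> F (set_val xi).
Proof.
move=> gh.
have [[cX _ _ _] _ _] := gps_compactification X.
have [u [_ cu]] : [set: hat] `&` cluster ((i \o h) x @[x --> +oo]) !=set0.
  by apply: cX; exact: filterT.
have limF (F : set hat) T :
    closed F -> (forall t, T <= t -> F (i (h t))) -> F u.
  move=> cF Fh; apply: contrapT => nFu.
  have [||v [Fv nFv]] := cu F (~` F).
  - by exists T; split; [exact: num_real|move=> t /ltW; exact: Fh].
  - by apply: open_nbhs_nbhs; split=> //; exact: closed_openC.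
  - exact: nFv.
suff bu : boundary i u.
  by have [xi xiu] := boundary_point bu; exists xi; rewrite xiu.
(* If the cluster point were [y] in X, take [y] as the base point: its Gromov
   product with every point is 0, but that of [h s] and [h t] is at least
   [s - d(h 0,y)] for [0 <= s <= t]. *)
move=> [y _ yu].
pose s := mdist (h 0) y + 1.
have s0 : 0 <= s by rewrite addr_ge0// mdist_ge0.
have : [set v | rho_hat y (i (h s)) v <= expR (- 1)] u.
  apply: (limF _ s).
    by apply: closed_le_fun; [exact: rho_hat_continuousr|exact: cst_continuous].
  move=> t st /=; rewrite rho_hat_incl ler_expR /gromov_product.
  have t0 : 0 <= t by apply: le_trans st.
  have E1 := gh 0 s I I; have E2 := gh 0 t I I; have E3 := gh s t I I.
  rewrite sub0r normrN ger0_norm// in E1.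
  rewrite sub0r normrN ger0_norm// in E2.
  rewrite distrC ger0_norm ?subr_ge0// in E3.
  have := metric_triangle (h 0) y (h s); have := metric_triangle (h 0) y (h t).
  rewrite (metric_sym y (h s)) (metric_sym y (h t)) E1 E2 E3 /s; lra.
rewrite -yu /= rho_hat_incl ler_expR /gromov_product mdistxx; lra.
Qed.

(** As [(a|xi)_p <= d(a,p)] in general ([rho_hat_incl_ge]), this inequality is
    the equality [(a|xi)_p = d(a,p)]. *)
Definition behind p a xi : Prop :=
  rho_hat p (i a) (set_val xi) <= expR (- mdist a p).

Lemma behind_exists p a : exists xi, behind p a xi.
Proof.
have [g [g0 ga gg]] := gps_geodesic p a.
have [h gh hg] := gps_complete (mdist_ge0 p a) gg.
have h0 : h 0 = p.
  by rewrite hg// in_itv/= lexx mdist_ge0.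
have ha : h (mdist p a) = a.
  by rewrite hg// in_itv/= lexx mdist_ge0.
have [xi Hxi] := line_end gh; exists xi.
apply: (Hxi [set v | rho_hat p (i a) v <= expR (- mdist a p)] (mdist p a)).
  by apply: closed_le_fun; [exact: rho_hat_continuousr|exact: cst_continuous].
move=> t dt /=; rewrite rho_hat_incl ler_expR /gromov_product.
have t0 : 0 <= t by apply: le_trans dt; exact: mdist_ge0.
have E1 := gh t 0 I I; rewrite h0 subr0 ger0_norm// in E1.
have E2 := gh (mdist p a) t I I.
rewrite ha distrC ger0_norm ?subr_ge0// in E2.
by rewrite E1 E2 (metric_sym a p); lra.
Qed.

Lemma incl_continuous : continuous i.
Proof.
have [[_ _ [_ oi] _] _ _] := gps_compactification X.
by apply/continuousP => A oA; apply/oi; exists A.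
Qed.

(** The function [rho_hat p a xi] of [a] in the closed ball of radius [r] is at
    least [e^(-d(a,p)) >= e^(-r)]. A point where it attains its minimum is as
    required, provided that the minimum is at most [e^(-r)]: points at distance
    [r] on geodesics from [p] to points [y] close to [xi] come as close to this
    value as desired. *)
Lemma in_front_exists p r xi : 0 <= r ->
  exists2 a, mdist a p = r & behind p a xi.
Proof.
move=> r0; pose u : hat := set_val xi.
have K0 : cball p r !=set0 by exists p; rewrite /cball /= mdistxx.
have cf : continuous (fun a => rho_hat p (i a) u).
  apply: continuous_rho_hat_comp; first exact: incl_continuous.
  exact: cst_continuous.
have [a] := compact_EVT_min K0 (gps_proper (p := p) (r := r))
  (continuous_subspaceT cf).
rewrite inE /cball /= => ar amin.
have far : rho_hat p (i a) u <= expR (- r).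
  rewrite leNgt; apply/negP => lt.
  have m0 : 0 < rho_hat p (i a) u - expR (- r) by rewrite subr_gt0.
  have [delta delta0 Hdelta] := rho_hat_modulus p m0.
  have uu0 : rho_hat p u u = 0.
    by apply/(rho_hat_boundary0 p) => //; exact: boundary_set_val.
  have [[_ _ _ dn] _ _] := gps_compactification X.
  have [||v [/= vlt [y _ yv]]] :=
      dn [set v | rho_hat p u v < Num.min delta (expR (- r))].
  - by exists u; rewrite /= uu0 lt_min delta0 expR_gt0.
  - apply: (@open_comp _ _ (rho_hat p u) [set x | x < _]); last exact: open_lt.
    by move=> v _; exact: rho_hat_continuousr.
  move: vlt; rewrite -yv lt_min => /andP[ud ur].
  have ry : r < mdist y p.
    have := le_lt_trans (rho_hat_incl_ge p y u) (_ : _ < expR (- r)).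
    by rewrite rho_hat_sym => /(_ ur); rewrite ltr_expR ltrN2.
  have [g [g0 gy gg]] := gps_geodesic p y.
  rewrite metric_sym in gy gg.
  have d0 : 0 <= mdist y p by exact: mdist_ge0.
  have I0 : `[0, mdist y p]%classic (0 : R) by rewrite /= in_itv/= lexx.
  have Ir : `[0, mdist y p]%classic r by rewrite /= in_itv/= r0 ltW.
  have Id : `[0, mdist y p]%classic (mdist y p) by rewrite /= in_itv/= lexx d0.
  have E1 := gg _ _ I0 Ir; rewrite sub0r normrN ger0_norm// g0 in E1.
  have E2 := gg _ _ Ir Id.
  rewrite gy distrC ger0_norm ?subr_ge0 ?(ltW ry)// in E2.
  have E3 : rho_hat p (i y) (i (g r)) = expR (- r).
    rewrite rho_hat_incl /gromov_product (metric_sym (g r) p) E1.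
    by rewrite (metric_sym y (g r)) E2; congr expR; lra.
  have := Hdelta _ _ ud (i (g r)); rewrite E3 ltr_norml => /andP[_].
  rewrite ltrD2r rho_hat_sym ltNge amin// inE /cball /=.
  by rewrite E1.
exists a => //.
  apply/eqP; rewrite eq_le (metric_sym a p) ar /=.
  have := le_trans (rho_hat_incl_ge p a u) far.
  by rewrite ler_expR lerN2 metric_sym.
rewrite /behind (le_trans far)// ler_expR lerN2 metric_sym //.
Qed.

(** Gromov products do not decrease when a point moves away from [p] along a
    ray. *)
Lemma rho_hat_behind_le p a xi v : behind p a xi ->
  rho_hat p (set_val xi) v <= rho_hat p (i a) v.
Proof.
move=> axi; apply: le_trans (rho_hat_triangle p a _ _) _.
rewrite -[leRHS]mul1r ler_wpM2r ?rho_hat_ge0//.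
by rewrite -(expRxMexpNx_1 (mdist a p)) ler_wpM2l ?expR_ge0.
Qed.

Lemma boundary_rho_le_rho_hat p a b xi eta : behind p a xi -> behind p b eta ->
  boundary_rho p xi eta <= rho_hat p (i a) (i b).
Proof.
move=> axi beta; rewrite boundary_rhoE (le_trans (rho_hat_behind_le _ axi))//.
by rewrite rho_hat_sym (rho_hat_sym p (i a)) rho_hat_behind_le.
Qed.

(** The two ends of a line through [a] and [b]: Gromov products of points beyond
    [a] with points beyond [b] are at most [(a|b)_p], and for a point [u] beyond
    [a] the triangle inequality [d(u,b) <= d(u,p) + d(p,b)] gives
    [(a|u)_p >= d(a,p) - (a|b)_p]. *)
Lemma line_through p a b : exists xi eta,
  [/\ rho_hat p (i a) (i b) <= boundary_rho p xi eta,
      rho_hat p (i a) (set_val xi) * rho_hat p (i a) (i b)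
        <= expR (- mdist a p) &
      rho_hat p (i b) (set_val eta) * rho_hat p (i a) (i b)
        <= expR (- mdist b p)].
Proof.
have [g [g0 gb gg]] := gps_geodesic a b.
have L0 : 0 <= mdist a b by exact: mdist_ge0.
have [h gh hg] := gps_complete L0 gg.
set L := mdist a b in gb gg hg L0.
have h0 : h 0 = a by rewrite hg// in_itv/= lexx L0.
have hb : h L = b by rewrite hg// in_itv/= lexx L0.
have gk : geodesic_on setT (h \o -%R).
  by move=> s t _ _; rewrite /= gh// opprK addrC distrC.
have dh s t : s <= t -> mdist (h s) (h t) = t - s.
  by move=> st; rewrite gh// distrC ger0_norm ?subr_ge0.
have [xi Hxi] := line_end gk; have [eta Heta] := line_end gh.
have tri := @metric_triangle _ X.
have sym := @metric_sym _ X.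
exists xi, eta; split.
- apply: (Heta [set v | rho_hat p (i a) (i b) <= rho_hat p (set_val xi) v] L).
    by apply: closed_le_fun; [exact: cst_continuous|exact: rho_hat_continuousr].
  move=> t Lt /=; rewrite rho_hat_sym.
  apply: (Hxi [set u | rho_hat p (i b) (i a) <= rho_hat p u (i (h t))] 0).
    apply: closed_le_fun; first exact: cst_continuous.
    by apply: continuous_rho_hat_comp => ?; [exact: cvg_id|exact: cvg_cst].
  move=> s s0 /=; rewrite !rho_hat_incl ler_expR /gromov_product.
  have := dh (- s) 0; have := dh L t Lt; have := dh (- s) t.
  rewrite h0 hb => D1 D2 D3; rewrite D1; last by lra.
  have := tri (h (- s)) a p; have := tri (h t) b p.
  rewrite (sym (h t) b) D2 D3; last by lra.
  by rewrite (sym b a) -/L; lra.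
- apply: (Hxi [set u | rho_hat p (i a) u * rho_hat p (i a) (i b)
        <= expR (- mdist a p)] 0).
    apply: closed_le_fun; last exact: cst_continuous.
    by move=> u; apply: cvgM; [exact: rho_hat_continuousr|exact: cvg_cst].
  move=> s s0 /=; rewrite !rho_hat_incl -expRD ler_expR /gromov_product.
  have := dh (- s) 0; have := dh (- s) L.
  rewrite h0 hb => D1 D2.
  have := tri (h (- s)) p b.
  rewrite D1; last by lra.
  rewrite (sym a (h _)) D2; last by lra.
  by rewrite (sym p b) -/L; lra.
- apply: (Heta [set u | rho_hat p (i b) u * rho_hat p (i a) (i b)
        <= expR (- mdist b p)] L).
    apply: closed_le_fun; last exact: cst_continuous.
    by move=> u; apply: cvgM; [exact: rho_hat_continuousr|exact: cvg_cst].
  move=> t Lt /=; rewrite !rho_hat_incl -expRD ler_expR /gromov_product.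
  have := dh L t Lt; have := dh 0 t.
  rewrite h0 hb => D1 D2.
  have := tri a p (h t).
  rewrite D1; last by lra.
  by rewrite D2 (sym p (h t)) -/L; lra.
Qed.

Definition boundary_modulus p (e delta : R) : Prop :=
  forall xi eta zeta, boundary_rho p xi eta < delta ->
    `|boundary_rho p xi zeta - boundary_rho p eta zeta| <= e.

(** The ends of the line through [a] and [b] are close to [xi] and [eta] unless
    [rho_hat p a b] is below [e]; two applications of the modulus replace them
    by [xi] and [eta]. *)
Lemma rho_hat_le_boundary_rho p e delta a b xi eta :
  0 < e -> boundary_modulus p e delta ->
  expR (- mdist a p) < e * delta -> expR (- mdist b p) < e * delta ->
  behind p a xi -> behind p b eta ->
  rho_hat p (i a) (i b) <= boundary_rho p xi eta + 2 * e.
Proof.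
move=> e0 mod ad bd axi beta.
have rge0 : 0 <= boundary_rho p xi eta by exact: rho_hat_ge0.
have [small|large] := leP (rho_hat p (i a) (i b)) e; first by lra.
have [xi' [eta' [ab axi' beta']]] := line_through p a b.
have close c zeta zeta' : behind p c zeta -> expR (- mdist c p) < e * delta ->
    rho_hat p (i c) (set_val zeta') * rho_hat p (i a) (i b)
      <= expR (- mdist c p) -> boundary_rho p zeta zeta' < delta.
  move=> cz cd cz'; apply: le_lt_trans (rho_hat_behind_le _ cz) _.
  rewrite -(ltr_pM2l e0); apply: le_lt_trans (le_lt_trans cz' cd).
  by rewrite mulrC ler_wpM2l ?rho_hat_ge0// ltW.
have := mod _ _ eta' (close _ _ _ axi ad axi').
have := mod _ _ xi (close _ _ _ beta bd beta').
have sym z z' : boundary_rho p z z' = boundary_rho p z' z.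
  exact: rho_hat_sym.
rewrite (sym eta xi) (sym eta' xi) !ler_norml => /andP[h1 _] /andP[h2 _].
lra.
Qed.

End rays.

(** * Boundary maps from correspondences *)

Lemma gromov_product_ge0 (R : realType) (X : metricType R) (p y z : X) :
  0 <= gromov_product p y z.
Proof.
rewrite /gromov_product mulr_ge0 ?invr_ge0// subr_ge0 (metric_sym z p).
exact: metric_triangle.
Qed.

Lemma rho_hat_perturb (R : realType) (X1 X2 : gromovProductSpace R)
    (p1 a a' : X1) (p2 b b' : X2) (tau : R) :
  `|mdist a p1 - mdist b p2| <= tau -> `|mdist a' p1 - mdist b' p2| <= tau ->
  `|mdist a a' - mdist b b'| <= tau ->
  rho_hat p1 (gps_incl a) (gps_incl a')
    <= rho_hat p2 (gps_incl b) (gps_incl b') + 2 * tau.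
Proof.
move=> ab ab' aabb; rewrite !rho_hat_incl.
apply: le_trans (expRN_lipschitz (gromov_product p2 b b') _) _.
  exact: gromov_product_ge0.
rewrite lerD2l /gromov_product.
have tau0 : 0 <= tau by apply: le_trans ab.
move: ab ab' aabb; rewrite !ler_norml => /andP[? ?] /andP[? ?] /andP[? ?].
by apply/andP; split; lra.
Qed.

(** The map goes from [xi] to a point in front of it on the sphere of radius
    [r], to a partner of that point, and to a boundary point behind the partner.
    The partner is at distance at least [r - tau] from the base point, whence the
    form of the bound on [r]. *)
Lemma correspondence_eps_isometry (R : realType) (X1 X2 : gromovProductSpace R)
    (p1 : X1) (p2 : X2) (C : X1 -> X2 -> Prop) (e delta tau r eps : R) :
  0 < e -> boundary_modulus p1 e delta -> boundary_modulus p2 e delta ->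
  0 <= tau -> 0 <= r -> expR (tau - r) < e * delta -> 2 * e + 2 * tau < eps ->
  (forall a b, C a b -> `|mdist a p1 - mdist b p2| <= tau) ->
  (forall a b a' b', C a b -> C a' b' ->
    `|mdist a a' - mdist b b'| <= tau) ->
  (forall a, mdist a p1 = r -> exists b, C a b) ->
  (forall b, mdist b p2 = r -> exists a, C a b) ->
  exists f : gromov_boundary X1 -> gromov_boundary X2,
    semimetric_eps_isometry (boundary_rho p1) (boundary_rho p2) eps f.
Proof.
move=> e0 mod1 mod2 tau0 r0 small lteps Cp Cd CL CR.
have fP (xi : gromov_boundary X1) : exists eta : gromov_boundary X2,
    exists a b, [/\ mdist a p1 = r, behind p1 a xi, C a b & behind p2 b eta].
  have [a ar axi] := in_front_exists p1 xi r0.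
  have [b Cab] := CL _ ar.
  by have [eta beta] := behind_exists p2 b; exists eta, a, b.
have [f Hf] := choice fP; exists f.
have far1 a b : C a b -> mdist b p2 = r -> expR (- mdist a p1) < e * delta.
  move=> /Cp; rewrite ler_norml => /andP[h _] br.
  by apply: le_lt_trans small; rewrite ler_expR; lra.
have far2 a b : C a b -> mdist a p1 = r -> expR (- mdist b p2) < e * delta.
  move=> /Cp; rewrite ler_norml => /andP[_ h] ar.
  by apply: le_lt_trans small; rewrite ler_expR; lra.
have farr (s : R) : s = r -> expR (- s) < e * delta.
  by move=> ->; apply: le_lt_trans small; rewrite ler_expR; lra.
have up a b a' b' : C a b -> C a' b' ->
    rho_hat p1 (gps_incl a) (gps_incl a')
    <= rho_hat p2 (gps_incl b) (gps_incl b') + 2 * tau.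
  by move=> Cab Cab'; apply: rho_hat_perturb; [exact: Cp|exact: Cp|exact: Cd].
have down a b a' b' : C a b -> C a' b' ->
    rho_hat p2 (gps_incl b) (gps_incl b')
    <= rho_hat p1 (gps_incl a) (gps_incl a') + 2 * tau.
  move=> Cab Cab'.
  by apply: rho_hat_perturb; rewrite distrC; [exact: Cp|exact: Cp|exact: Cd].
split.
  apply: (@le_lt_trans _ _ (2 * e + 2 * tau)%:E); last by rewrite lte_fin.
  apply: ge_ereal_sup => _ [[xi xi'] _ <-]; rewrite lee_fin /=.
  have [a [b [ar axi Cab beta]]] := Hf xi.
  have [a' [b' [ar' axi' Cab' beta']]] := Hf xi'.
  have U := up _ _ _ _ Cab Cab'; have D := down _ _ _ _ Cab Cab'.
  have l1 := boundary_rho_le_rho_hat axi axi'.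
  have l2 := boundary_rho_le_rho_hat beta beta'.
  have g1 :=
    rho_hat_le_boundary_rho e0 mod1 (farr _ ar) (farr _ ar') axi axi'.
  have g2 := rho_hat_le_boundary_rho e0 mod2
    (far2 _ _ Cab ar) (far2 _ _ Cab' ar') beta beta'.
  by rewrite ler_norml; apply/andP; split; lra.
(* To approximate [eta], go backwards: a point in front of [eta], its partner
   [a'], and [xi] behind [a']. The map [f] may use another point [a] in front of
   [xi], but [a] and [a'] are close, both being in front of [xi]. *)
move=> eta.
have [b' br' beta'] := in_front_exists p2 eta r0.
have [a' Cab'] := CR _ br'.
have [xi axi'] := behind_exists p1 a'.
exists xi; apply: le_lt_trans lteps.
have [a [b [ar axi Cab beta]]] := Hf xi.
have D := down _ _ _ _ Cab Cab'.
have l2 := boundary_rho_le_rho_hat beta beta'.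
have g1 := rho_hat_le_boundary_rho e0 mod1
  (farr _ ar) (far1 _ _ Cab' br') axi axi'.
have : boundary_rho p1 xi xi = 0.
  by apply/(rho_hat_boundary0 p1) => //; exact: boundary_set_val.
by lra.
Qed.

Lemma boundary_modulus_exists (R : realType) (X : gromovProductSpace R) (p : X)
  (e : R) : 0 < e -> exists2 delta, 0 < delta & boundary_modulus p e delta.
Proof.
move=> e0; have [delta delta0 H] := rho_hat_modulus p e0.
by exists delta => // xi eta zeta lt; apply/ltW/H.
Qed.

Lemma boundary_modulusW (R : realType) (X : gromovProductSpace R) (p : X)
    (e delta delta' : R) : delta' <= delta ->
  boundary_modulus p e delta -> boundary_modulus p e delta'.
Proof. by move=> le mod xi eta zeta lt; apply: mod; exact: lt_le_trans le. Qed.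

Lemma equicontinuous_boundary_modulus (R : realType) (I : Type)
    (X_ : I -> gromovProductSpace R) (x_ : forall n, X_ n) (e : R) :
  equicontinuous_family (fun n => boundary_rho (x_ n)) -> 0 < e ->
  exists2 delta, 0 < delta & forall n, boundary_modulus (x_ n) e delta.
Proof.
move=> equi e0; have [delta delta0 H] := equi _ e0.
exists delta => // n xi eta zeta /H lt.
rewrite -lee_fin; apply: le_trans (ltW lt).
by apply: ereal_sup_ubound; exists zeta.
Qed.

Lemma ai_converges_le (R : realType) (Z_ : nat -> Type)
    (rho_ : forall n, Z_ n -> Z_ n -> R) (Z : Type) (rho : Z -> Z -> R) :
  (forall eps, 0 < eps -> \forall n \near \oo,
    (exists f, semimetric_eps_isometry (rho_ n) rho eps f) /\
    (exists g, semimetric_eps_isometry rho (rho_ n) eps g)) ->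
  ai_converges rho_ rho.
Proof.
move=> H.
have ge0 n : (0 <= ai_dist (rho_ n) rho)%E.
  by apply: le_ereal_inf_tmp => _ [e [e0 _ _] <-]; rewrite lee_fin ltW.
have le eps : 0 < eps ->
    \forall n \near \oo, (ai_dist (rho_ n) rho <= eps%:E)%E.
  move=> eps0; apply: filterS (H _ eps0) => n [ex1 ex2].
  by apply: ereal_inf_lbound; exists eps.
have fin : \forall n \near \oo, ai_dist (rho_ n) rho \is a fin_num.
  apply: filterS (le 1 ltr01) => n; move: (ge0 n).
  by case: (ai_dist _ _).
apply/fine_cvgP; split => //; apply/cvgrPdist_le => eps eps0.
near=> n.
rewrite sub0r normrN ger0_norm ?fine_ge0//.
rewrite -lee_fin fineK; first by near: n; exact: le.
by near: n.
Unshelve. all: by end_near. Qed.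

(** * Convergence of boundaries *)

Theorem theorem1p3 (R : realType)
  (X_ : nat -> gromovProductSpace R) (x_ : forall n, X_ n)
  (X : gromovProductSpace R) (x : X)
  (hGH : pointed_gh_converges x_ x)
  (hantipodal : forall n, antipodal_space (boundary_rho (x_ n)))
  (hequi : equicontinuous_family (fun n => boundary_rho (x_ n))) :
  ai_converges (fun n => boundary_rho (x_ n)) (boundary_rho x).
Proof.
apply: ai_converges_le => eps eps0.
(* The total error is [2 * e + 2 * tau], at most [eps / 2]. *)
pose e := eps / 8; have e0 : 0 < e by rewrite divr_gt0.
have [dn dn0 modn] := equicontinuous_boundary_modulus hequi e0.
have [dx dx0 modx] := boundary_modulus_exists x e0.
pose delta := Num.min dn dx.
have delta0 : 0 < delta by rewrite lt_min dn0.
pose tau := Num.min 1 e.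
have tau0 : 0 < tau by rewrite lt_min ltr01.
have [tau1 taue] : tau <= 1 /\ tau <= e by rewrite !ge_min !lexx orbT.
pose r := 1 + (e * delta)^-1.
have ed0 : 0 < e * delta by rewrite mulr_gt0.
have r0 : 0 < r by rewrite addr_gt0// invr_gt0.
(* From [tau <= 1] and [exp x > x]. *)
have small : expR (tau - r) < e * delta.
  apply: (@le_lt_trans _ _ (expR (- (e * delta)^-1))).
    by rewrite ler_expR /r; lra.
  rewrite expRN invf_plt ?posrE ?expR_gt0//.
  by apply: lt_le_trans (expR_ge1Dx _); rewrite ltrDr.
have lteps : 2 * e + 2 * tau < eps.
  by move: taue; rewrite /e; lra.
have tau3 : 0 < tau / 3 by rewrite divr_gt0.
apply: filterS (hGH _ _ r0 tau3) => n [f [fun_f dis sur] fx].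
have {}modn : boundary_modulus (x_ n) e delta.
  by apply: boundary_modulusW (modn n); rewrite ge_min lexx.
have {}modx : boundary_modulus x e delta.
  by apply: boundary_modulusW modx; rewrite ge_min lexx orbT.
have {}dis a a' : cball (x_ n) r a -> cball (x_ n) r a' ->
    `|mdist (f a) (f a') - mdist a a'| <= tau / 3.
  move=> ar ar'; rewrite -lee_fin; apply: le_trans (ltW dis).
  by apply: ereal_sup_ubound; exists (a, a').
have pr : cball (x_ n) r (x_ n) by rewrite /cball /= mdistxx ltW.
(* A point of the second ball may have several almost-preimages, and images
   need not lie on the sphere: hence a relation. *)
pose C a b := cball (x_ n) r a /\ mdist (f a) b <= tau / 3.
have Cp a b : C a b -> `|mdist a (x_ n) - mdist b x| <= tau.
  move=> [ar ab]; have := dis _ _ ar pr; rewrite fx !ler_norml => /andP[h1 h2].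
  have := metric_triangle (f a) b x; have := metric_triangle b (f a) x.
  by rewrite (metric_sym b (f a)) => h3 h4; apply/andP; split; lra.
have Cd a b a' b' : C a b -> C a' b' -> `|mdist a a' - mdist b b'| <= tau.
  move=> [ar ab] [ar' ab']; have := dis _ _ ar ar'.
  rewrite !ler_norml => /andP[h1 h2].
  have := metric_triangle (f a) b (f a').
  have := metric_triangle b b' (f a').
  have := metric_triangle b (f a) b'.
  have := metric_triangle (f a) (f a') b'.
  rewrite (metric_sym b (f a)) (metric_sym b' (f a')) => h3 h4 h5 h6.
  by apply/andP; split; lra.
have CL a : mdist a (x_ n) = r -> exists b, C a b.
  move=> ar; exists (f a); split; first by rewrite /cball /= metric_sym ar.
  by rewrite mdistxx ltW.
have CR b : mdist b x = r -> exists a, C a b.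
  move=> br; have [|a ar ab] := sur b; first by rewrite /cball /= metric_sym br.
  by exists a.
split.
- exact: (correspondence_eps_isometry e0 modn modx (ltW tau0) (ltW r0)
    small lteps Cp Cd CL CR).
- apply: (correspondence_eps_isometry (C := fun b a => C a b) e0 modx modn
    (ltW tau0) (ltW r0) small lteps _ _ CR CL).
  + by move=> b a /Cp; rewrite distrC.
  + by move=> b a b' a' Cab Cab'; rewrite distrC; exact: Cd.
Qed.
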